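(* Let $(F,d_F)$ and $(G,d_G)$ be metric Fréchet spaces whose metrics are both of supremum form. Let $U\subset F$ be open, $x_0\in U$, $R\in(0,\infty]$, and let $f:U\to G$ be b-differentiable with radius $R$. Suppose that $f'(x_0):F\to G$ is injective with an $R$-bounded left inverse $L_0\in B_R(G,F)$ (i.e. $L_0\circ f'(x_0)=\mathrm{id}_F$). Then there is a real number $r_0>0$ such that the restriction $f|_{B(x_0,r_0)}$ has a continuous left inverse, i.e. a continuous map $\phi$ defined on $f(B(x_0,r_0))$ with $\phi(f(x))=x$ for all $x\in B(x_0,r_0)$ (in particular $f|_{B(x_0,r_0)}$ is injective).
   Context: A Fréchet space is a locally convex topological vector space whose topology can be induced by a complete translation-invariant metric; a metric Fréchet space $(F,d_F)$ is a Fréchet space together with such a metric. $B(x_0,r_0)$ is the open $d_F$-ball of radius $r_0$ around $x_0$. Supremum form: there are a countable family of continuous seminorms $\|\cdot\|_n$, $n\in\mathbb{N}$, whose balls form a basis of the topology, and a positive sequence $(\alpha_n)$ converging to $0$, such that $d(x,y)=\sup_{n}\alpha_n\Phi(\|x-y\|_n)$, where $\Phi(t)=t/(1+t)$. For metric Fréchet spaces $(F,d_F),(G,d_G)$, $r\in(0,\infty]$ and a linear map $A:F\to G$ put $\langle A\rangle_r:=\sup_{0\neq p\in F,\ d_F(p,0)<r} d_G(Ap,0)/d_F(p,0)$. $A$ is called $r$-bounded if $\langle A\rangle_r<\infty$, and $B_r(F,G)$ denotes the set of $r$-bounded linear maps with the metric $(A,B)\mapsto\langle A-B\rangle_r$.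 A map $Q:U\to G$ on an open set $U\subset F$ is differentiable at $p\in U$ if there is a linear map $dQ(p)=Q'(p):F\to G$ with $dQ(p)v=\lim_{t\to0}(Q(p+tv)-Q(p))/t$ for all $v\in F$. $Q$ is b-differentiable with radius $R$ if it is differentiable at every $p\in U$, $dQ(p)\in B_R(F,G)$ for all $p\in U$, and $dQ:U\to B_R(F,G)$ is continuous. *)

(* Defs.v *)
From HB Require Import structures.
From mathcomp Require Import all_boot all_order all_algebra.
From mathcomp Require Import all_classical all_reals all_analysis.

Set Implicit Arguments.
Unset Strict Implicit.
Unset Printing Implicit Defensive.

Import Order.TTheory GRing.Theory Num.Theory.
Import numFieldNormedType.Exports.

Local Open Scope classical_set_scope.
Local Open Scope ring_scope.

Definition dball (R : realType) (E : tvsType R) (d : E -> E -> R)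
    (x : E) (r : R) : set E :=
  [set y | d x y < r].

(* A metric Frechet space is a pair of a (locally convex) E : tvsType R and a
   function d satisfying this predicate.  The metric is separate data because
   the library hierarchy has no join of Tvs and Metric. *)
Record frechet_metric (R : realType) (E : tvsType R) (d : E -> E -> R) : Prop := {
  fdist_eq0 : forall x y, d x y = 0 <-> x = y ;
  fdist_sym : forall x y, d x y = d y x ;
  fdist_triangle : forall x y z, d x z <= d x y + d y z ;
  fdist_translation : forall x y z, d (x + z) (y + z) = d x y ;
  fdist_topology : forall (x : E) (A : set E),
    nbhs x A <-> exists2 e : R, 0 < e & dball d x e `<=` A ;
  fdist_complete : forall u : nat -> E,
    (forall e : R, 0 < e ->
       exists N : nat, forall m n : nat,
         (N <= m)%N -> (N <= n)%N -> d (u m) (u n) < e) ->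
    exists l : E, u @ \oo --> l
}.

Definition seminorm (R : realType) (E : lmodType R) (p : E -> R) : Prop :=
  (forall x y, p (x + y) <= p x + p y) /\
  (forall (a : R) x, p (a *: x) = `|a| * p x).

Definition Phi (R : realType) (t : R) : R := t / (1 + t).

Definition supremum_form (R : realType) (E : tvsType R) (d : E -> E -> R) : Prop :=
  exists (p : nat -> E -> R) (alpha : nat -> R),
    [/\ forall n, seminorm (p n) /\ continuous (p n),
        basis [set B : set E | exists x n (e : R),
          0 < e /\ B = [set y | p n (y - x) < e]],
        forall n, 0 < alpha n,
        alpha @ \oo --> (0 : R)
      & forall x y, d x y =
          sup [set alpha n * Phi (p n (x - y)) | n in [set: nat]]].

(* The supremum is taken in [0, +oo], so that it is 0 when no p qualifies. *)
Definition rsize (R : realType) (F G : tvsType R)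
    (dF : F -> F -> R) (dG : G -> G -> R) (r : \bar R) (A : F -> G) : \bar R :=
  ereal_sup ([set 0%E] `|`
    [set (dG (A p) 0 / dF p 0)%:E |
       p in [set p : F | p != 0 /\ ((dF p 0)%:E < r)%E]]).

Definition rbounded (R : realType) (F G : tvsType R)
    (dF : F -> F -> R) (dG : G -> G -> R) (r : \bar R) : set {linear F -> G} :=
  [set A : {linear F -> G} | (rsize dF dG r A < +oo)%E].

(* derive and 'D_v f are only available between normed modules. *)
Definition is_derivative (R : realType) (F G : tvsType R)
    (Q : F -> G) (p : F) (A : {linear F -> G}) : Prop :=
  forall v : F, t^-1 *: (Q (p + t *: v) - Q p) @[t --> (0 : R)^'] --> A v.

(* A map on the open set U is encoded by a total function whose values outside U
   are irrelevant; dQ is determined by Q on U and arbitrary outside.  The last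
   clause is continuity of dQ on U for the metric
   (A, B) |-> rsize dF dG rad (A - B). *)
Definition b_differentiable (R : realType) (F G : tvsType R)
    (dF : F -> F -> R) (dG : G -> G -> R) (rad : \bar R)
    (U : set F) (Q : F -> G) (dQ : F -> {linear F -> G}) : Prop :=
  [/\ forall p, U p -> is_derivative Q p (dQ p),
      forall p, U p -> rbounded dF dG rad (dQ p)
    & forall p, U p ->
        rsize dF dG rad (dQ q \- dQ p) @[q --> within U (nbhs p)] --> 0%E].

(* Main.v *)
Require Import Defs.
From HB Require Import structures.
From mathcomp Require Import all_boot all_order all_algebra.
From mathcomp Require Import all_classical all_reals all_analysis.
From mathcomp Require Import ring lra.

Set Implicit Arguments.
Unset Strict Implicit.
Unset Printing Implicit Defensive.

Import Order.TTheory GRing.Theory Num.Theory.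
Import numFieldNormedType.Exports.

Local Open Scope classical_set_scope.
Local Open Scope ring_scope.

(** Why the theorem holds.  Put g = f - f'(x0).  By continuity of the derivative,
the size of g' is at most eps on a small ball around x0, and the heart of the
proof is that g is then eps-Lipschitz for the two metrics on that ball
(increment_error_le).  Since x - y = L0 (f'(x0) (x - y)), this gives
    dF x y <= dF (L0 (f x - f y)) 0 + dF (L0 (g x - g y)) 0,
where the last term is at most C * eps * dF x y if C bounds L0.  With
C * eps <= 1/2 it is absorbed in the left-hand side, and
    dF x y <= 2 * C * dG (f x) (f y)
as soon as f x and f y are close enough for the bound on L0 to apply.  Such a
local estimate makes f injective with a continuous inverse
(lipschitz_left_inverse).  No fixed point argument is involved, because only a
left inverse is asked for.

The Lipschitz estimate for g is not automatic: a translation-invariant metric is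
not homogeneous, so a bound on the distance of a derivative to 0 does not pass
to difference quotients by itself.  The supremum form is what helps.  Up to the
nondecreasing function Phi, the metric is a supremum of seminorms; each
seminorm obeys the classical mean value inequality (seminorm_mean_value), and
the condition dG l 0 <= M unfolds to one upper bound on each seminorm of l.
Hence the mean value inequality holds for the metric with no loss of constant
(fdist_mean_value).  For the same reason balls are convex (dball_segment), so
that the segment from y to x stays where g' is small.  The estimate needs
dF x y below the radius of b-differentiability, which the choice of r0 ensures. *)

(** * Metrics of supremum form *)

Lemma Phi_lt1 (R : realType) (t : R) : 0 <= t -> Phi t < 1.
Proof. by move=> t0; rewrite /Phi ltr_pdivrMr; lra. Qed.

Lemma Phi_gt0 (R : realType) (t : R) : 0 < t -> 0 < Phi t.
Proof. by move=> t0; rewrite /Phi divr_gt0//; lra. Qed.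

(** Clearing the denominator makes the condition on t affine, which is how a bound
    on the metric becomes a bound on a seminorm. *)
Lemma mulr_Phi_le (R : realType) (a M t : R) :
  0 <= t -> (a * Phi t <= M) = (a * t <= M * (1 + t)).
Proof. by move=> t0; rewrite /Phi mulrA ler_pdivrMr//; lra. Qed.

Lemma mulr_Phi_lt (R : realType) (a s t : R) :
  0 < a -> 0 <= s -> 0 <= t -> a * Phi s < a * Phi t -> s < t.
Proof.
move=> a0 s0 t0; rewrite ltr_pM2l// /Phi ltr_pdivrMr; last by lra.
rewrite mulrAC ltr_pdivlMr; last by lra.
by lra.
Qed.

Lemma seminorm0 (R : realType) (E : lmodType R) (p : E -> R) :
  seminorm p -> p 0 = 0.
Proof. by case=> _ pZ; rewrite -(scale0r 0) pZ normr0 mul0r. Qed.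

Lemma seminorm_ge0 (R : realType) (E : lmodType R) (p : E -> R) (x : E) :
  seminorm p -> 0 <= p x.
Proof.
move=> sp; have p0 := seminorm0 sp; case: sp => pD pZ.
have := pD x (-1 *: x); rewrite pZ normrN1 scaleN1r subrr p0.
lra.
Qed.

(** The supremum as an upper bound and as the least one.  It exists because the
    convergent sequence a is bounded and Phi < 1. *)
Lemma supremum_form_gauge (R : realType) (E : tvsType R) (d : E -> E -> R) :
  supremum_form d ->
  exists (p : nat -> E -> R) (a : nat -> R),
    [/\ forall n, seminorm (p n),
        forall n, 0 < a n,
        forall n x y, a n * Phi (p n (x - y)) <= d x y
      & forall x y M, (forall n, a n * Phi (p n (x - y)) <= M) -> d x y <= M].
Proof.
case=> p [a [hp _ a0 acv hd]]; exists p, a; split => //.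
- by move=> n; case: (hp n).
- have [B /= aB] : exists B : R, forall n, a n <= B.
    have [B [_ aB]] := cvg_seq_bounded (cvgP _ acv).
    exists (B + 1) => n; apply: le_trans (ler_norm _) _.
    by apply: aB => //; rewrite ltrDl.
  move=> n x y; rewrite hd; apply: ub_le_sup; last by exists n.
  exists B => _ [m _ <-].
  apply: le_trans (aB m); rewrite ler_piMr ?(ltW (a0 m))//.
  by apply/ltW/Phi_lt1/seminorm_ge0; case: (hp m).
- move=> x y M hM; rewrite hd; apply: ge_sup; first by eexists; exists 0%N.
  by move=> _ [n _ <-].
Qed.

Lemma fdist_subr (R : realType) (E : tvsType R) (d : E -> E -> R) (x y : E) :
  frechet_metric d -> d x y = d (x - y) 0.
Proof. by move=> hd; rewrite -(fdist_translation hd x y (- y)) subrr. Qed.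

Lemma fdist_ge0 (R : realType) (E : tvsType R) (d : E -> E -> R) (x y : E) :
  frechet_metric d -> 0 <= d x y.
Proof.
move=> hd; have := fdist_triangle hd x y x.
have /(fdist_eq0 hd) -> : x = x by [].
by rewrite (fdist_sym hd y x); lra.
Qed.

(** Each p n is convex, hence bounded on a segment by its larger value at the ends;
    this quasi-convexity survives composition with the monotone Phi and suprema,
    whereas convexity would not. *)
Lemma dball_segment (R : realType) (E : tvsType R) (d : E -> E -> R)
    (x0 x y : E) (r t : R) :
  frechet_metric d -> supremum_form d ->
  dball d x0 r x -> dball d x0 r y -> 0 <= t <= 1 ->
  dball d x0 r (y + t *: (x - y)).
Proof.
move=> hd /supremum_form_gauge [p [a [hp a0 ale dle]]] xr yr /andP[t0 t1].
suff : d x0 (y + t *: (x - y)) <= Num.max (d x0 x) (d x0 y).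
  by move=> h; apply: le_lt_trans h _; rewrite gt_max; apply/andP; split.
apply: dle => n.
have [pD pZ] := hp n.
have pc : p n (x0 - (y + t *: (x - y))) <= t * p n (x0 - x) + (1 - t) * p n (x0 - y).
  have -> : x0 - (y + t *: (x - y)) = t *: (x0 - x) + (1 - t) *: (x0 - y).
    rewrite scalerBl scale1r addrCA -scalerBr opprD addrA -scalerN !opprB.
    by rewrite (addrC (x0 - x)) subrKA.
  apply: le_trans (pD _ _) _.
  by rewrite !pZ !ger0_norm//; lra.
have x_ge0 := seminorm_ge0 (x0 - x) (hp n).
have y_ge0 := seminorm_ge0 (x0 - y) (hp n).
have z_ge0 := seminorm_ge0 (x0 - (y + t *: (x - y))) (hp n).
have an := a0 n.
have pmax : p n (x0 - (y + t *: (x - y))) <= Num.max (p n (x0 - x)) (p n (x0 - y)).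
  rewrite le_max; case: (leP (p n (x0 - x)) (p n (x0 - y))) => h.
    by apply/orP; right; nra.
  by apply/orP; left; nra.
move: pmax; rewrite !le_max => /orP[] h; apply/orP; [left|right].
  apply: le_trans (ale n _ _).
  by rewrite leNgt; apply/negP => /(mulr_Phi_lt an x_ge0 z_ge0); lra.
apply: le_trans (ale n _ _).
by rewrite leNgt; apply/negP => /(mulr_Phi_lt an y_ge0 z_ge0); lra.
Qed.

(** * The mean value inequality *)

(** A supremum argument with only pointwise control of h: let s be the last time t
    at which p (h t - h 0) <= K * t.  The local estimate at s shows both that s is
    such a time and that there is a later one unless s = 1. *)
Lemma seminorm_mean_value (R : realType) (E : lmodType R) (p : E -> R)
    (h : R -> E) (K : R) :
  seminorm p ->
  (forall c, 0 <= c <= 1 -> exists2 e : R, 0 < e &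
     forall t, `|t - c| < e -> p (h t - h c) <= K * `|t - c|) ->
  p (h 1 - h 0) <= K.
Proof.
move=> sp hloc; have p0 := seminorm0 sp; have [pD _] := sp.
have ptri u v w : p (u - w) <= p (u - v) + p (v - w).
  by have := pD (u - v) (v - w); rewrite addrA subrK.
have pdist u v : p (u - v) = p (v - u).
  have [_ pZ] := sp.
  by rewrite -[RHS]mul1r -(normrN1 R) -pZ scaleN1r opprB.
pose T := [set t : R | 0 <= t <= 1 /\ p (h t - h 0) <= K * t].
have T0 : T 0 by split; [lra | rewrite subrr p0 mulr0].
have supT : has_sup T.
  by split; [exists 0 | exists 1 => t [/andP[]]].
pose s := sup T.
have s01 : 0 <= s <= 1.
  apply/andP; split; first exact: (sup_upper_bound supT).
  by apply: ge_sup; [exists 0 | move=> t [/andP[]]].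
have [e e0 he] := hloc s s01.
have Ts : p (h s - h 0) <= K * s.
  have [t Tt st] := sup_adherent e0 supT.
  have ts : t <= s by exact: (sup_upper_bound supT).
  have := he t; rewrite ler0_norm; last by lra.
  have -> : - (t - s) = s - t by ring.
  rewrite pdist => /(_ ltac:(rewrite -/s in st; lra)) h1.
  have := ptri (h s) (h t) (h 0); case: Tt => _.
  by lra.
case: (ltP s 1) => [s1|s1]; last first.
  have s_eq : s = 1 by lra.
  by move: Ts; rewrite s_eq mulr1.
(* s < 1 would allow a step beyond s *)
pose t := Num.min 1 (s + e / 2).
have st : s < t by rewrite /t lt_min; apply/andP; split; lra.
have t1 : t <= 1 by rewrite ge_min lexx.
have te : t <= s + e / 2 by rewrite ge_min lexx orbT.
suff : T t by move=> /(sup_upper_bound supT); rewrite -/s; lra.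
split; first by lra.
have := he t; rewrite ger0_norm; last by lra.
move=> /(_ ltac:(lra)) h1.
by have := ptri (h t) (h s) (h 0); lra.
Qed.

(** A mean value inequality without any constant, although d is not homogeneous:
    dividing by s is harmless for a seminorm, and d l 0 <= M amounts to
    p n l <= M / (a n - M) for those n with M < a n, the other n being vacuous. *)
Lemma fdist_mean_value (R : realType) (G : tvsType R) (d : G -> G -> R)
    (h : R -> G) (M : R) :
  frechet_metric d -> supremum_form d ->
  (forall c, 0 <= c <= 1 -> exists2 l : G, d l 0 <= M &
     forall e : R, 0 < e -> exists2 r : R, 0 < r &
       forall s, s != 0 -> `|s| < r -> d (s^-1 *: (h (c + s) - h c)) l < e) ->
  d (h 1) (h 0) <= M.
Proof.
move=> hd /supremum_form_gauge [p [a [hp a0 ale dle]]] hder.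
apply: dle => n; have sp := hp n; have an := a0 n; have [pD pZ] := sp.
have M0 : 0 <= M.
  have [|l lM _] := hder 0; first by lra.
  by apply: le_trans lM; exact: fdist_ge0.
(* if a n <= M the n-th bound is vacuous, as Phi < 1 *)
have [aM|Ma] := leP (a n) M.
  apply: le_trans aM; rewrite ler_piMr ?ltW//.
  exact/Phi_lt1/seminorm_ge0.
rewrite mulr_Phi_le ?seminorm_ge0//.
(* K solves a n * Phi K = M *)
pose K := M / (a n - M).
have aMK x : (a n * x <= M * (1 + x)) = (x <= K).
  rewrite /K ler_pdivlMr; last by lra.
  by apply/idP/idP; lra.
rewrite aMK; apply/ler_addgt0Pr => eta eta0.
apply: seminorm_mean_value (sp) _ => c c01.
have [l lM hl] := hder c c01.
have plK : p n l <= K.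
  rewrite -aMK -mulr_Phi_le ?seminorm_ge0//.
  by apply: le_trans lM; rewrite -{1}(subr0 l); exact: ale.
have [|r r0 hr] := hl (a n * Phi eta); first by rewrite mulr_gt0 ?Phi_gt0.
exists r => // t tr.
have [->|tc] := eqVneq t c.
  by rewrite !subrr (seminorm0 sp) normr0 mulr0.
have s0 : t - c != 0 by rewrite subr_eq0.
have := hr _ s0 tr; rewrite (addrC c) subrK => /(le_lt_trans (ale n _ _)).
move=> /(mulr_Phi_lt an (seminorm_ge0 _ sp) (ltW eta0)) h1.
have := pD ((t - c)^-1 *: (h t - h c) - l) l; rewrite subrK pZ => h2.
have t0 : 0 < `|t - c| by rewrite normr_gt0.
rewrite -ler_pdivrMr// mulrC -normfV.
by lra.
Qed.

(** * Bounded linear maps and derivatives *)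

(** The case v = 0, which the supremum omits, is covered by A 0 = 0. *)
Lemma rsize_le (R : realType) (F G : tvsType R) (dF : F -> F -> R)
    (dG : G -> G -> R) (r : \bar R) (A : F -> G) (C : R) (v : F) :
  frechet_metric dF -> frechet_metric dG -> A 0 = 0 ->
  (rsize dF dG r A <= C%:E)%E -> ((dF v 0)%:E < r)%E ->
  dG (A v) 0 <= C * dF v 0.
Proof.
move=> hF hG A0 AC vr.
have [->|v0] := eqVneq v 0.
  have /(fdist_eq0 hG) -> : A 0 = 0 by [].
  have /(fdist_eq0 hF) -> : 0 = 0 :> F by [].
  by rewrite mulr0.
have dv : 0 < dF v 0.
  rewrite lt_neqAle fdist_ge0// andbT; apply/eqP => /esym /(fdist_eq0 hF) /eqP.
  by rewrite (negPf v0).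
rewrite -ler_pdivrMr// -lee_fin; apply: le_trans AC.
by apply: ereal_sup_ubound; right; exists v.
Qed.

Lemma rbounded_le (R : realType) (F G : tvsType R) (dF : F -> F -> R)
    (dG : G -> G -> R) (r : \bar R) (A : {linear F -> G}) :
  frechet_metric dF -> frechet_metric dG -> rbounded dF dG r A ->
  exists2 C : R, 0 <= C &
    forall v, ((dF v 0)%:E < r)%E -> dG (A v) 0 <= C * dF v 0.
Proof.
move=> hF hG Ar.
have r0 : (0 <= rsize dF dG r A)%E by apply: ereal_sup_ubound; left.
exists (fine (rsize dF dG r A)); first exact: fine_ge0.
move=> v; apply: rsize_le => //; first exact: linear0.
by rewrite fineK// ge0_fin_numE.
Qed.

Lemma is_derivative_fdist (R : realType) (F G : tvsType R) (dG : G -> G -> R)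
    (Q : F -> G) (p : F) (A : {linear F -> G}) (v : F) (e : R) :
  frechet_metric dG -> is_derivative Q p A -> 0 < e ->
  exists2 r : R, 0 < r & forall s, s != 0 -> `|s| < r ->
    dG (s^-1 *: (Q (p + s *: v) - Q p)) (A v) < e.
Proof.
move=> hG QA e0.
have /QA : nbhs (A v) (dball dG (A v) e) by apply/(fdist_topology hG); exists e.
move=> /nbhs_ballP [r /= r0 hr]; exists r => // s s0 sr.
rewrite (fdist_sym hG); apply: hr => //.
by rewrite /ball/= sub0r normrN.
Qed.

(** The mean value inequality for f - A along the segment from y to x, whose
    derivative (df q - A) (x - y) has size at most C * dF x y since
    dF x y < rad. *)
Lemma increment_error_le (R : realType) (F G : tvsType R) (dF : F -> F -> R)
    (dG : G -> G -> R) (f : F -> G) (df : F -> {linear F -> G})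
    (A : {linear F -> G}) (rad : \bar R) (x0 x y : F) (r C : R) :
  frechet_metric dF -> frechet_metric dG ->
  supremum_form dF -> supremum_form dG ->
  (forall q, dball dF x0 r q -> is_derivative f q (df q)) ->
  (forall q, dball dF x0 r q -> (rsize dF dG rad (df q \- A)%R <= C%:E)%E) ->
  dball dF x0 r x -> dball dF x0 r y -> ((dF x y)%:E < rad)%E ->
  dG (f x - f y) (A (x - y)) <= C * dF x y.
Proof.
move=> hF hG sF sG fdf dfA xr yr xy.
pose q t := y + t *: (x - y).
pose h t := f (q t) - A (q t).
have -> : dG (f x - f y) (A (x - y)) = dG (h 1) (h 0).
  rewrite (fdist_subr _ _ hG) [RHS](fdist_subr _ _ hG) /h /q.
  rewrite scale1r scale0r addr0 (addrC y) subrK linearB/=.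
  by congr dG; rewrite !opprB (addrC (A y)) addrACA (addrC (- f y)).
apply: fdist_mean_value => // c c01.
have qr : dball dF x0 r (q c) by exact: dball_segment.
exists ((df (q c) \- A) (x - y)).
  rewrite (fdist_subr x y hF); apply: rsize_le => //.
  - by rewrite /= !linear0 addr0.
  - exact: dfA.
  - by rewrite -fdist_subr.
move=> e e0.
have [s0 s0_gt0 hs] := is_derivative_fdist (x - y) hG (fdf _ qr) e0.
exists s0 => // s sn0 ss0; have := hs s sn0 ss0.
rewrite -(fdist_translation hG _ _ (- A (x - y))) /=.
congr (dG _ _ < _).
have qD : q (c + s) = q c + s *: (x - y) by rewrite /q scalerDl addrA.
have AD : A (q c + s *: (x - y)) = A (q c) + s *: A (x - y).
  by rewrite linearD linearZ.
rewrite /h qD AD opprB (addrC (A (q c)) (- f (q c))) addrACA opprD.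
by rewrite (addrAC (- A (q c))) addNr add0r [RHS]scalerBr scalerA mulVf// scale1r.
Qed.

(** * Continuous inverses from a local Lipschitz estimate *)

(** The estimate is only assumed for close values; equal values are close, so it
    still gives injectivity on B, and continuity is a local matter. *)
Lemma lipschitz_left_inverse (R : realType) (F G : tvsType R)
    (dF : F -> F -> R) (dG : G -> G -> R) (f : F -> G) (B : set F)
    (C : R) (rho : \bar R) :
  frechet_metric dF -> frechet_metric dG -> 0 <= C -> (0 < rho)%E ->
  (forall x y, B x -> B y -> ((dG (f x) (f y))%:E < rho)%E ->
     dF x y <= C * dG (f x) (f y)) ->
  exists phi : G -> F,
    {within f @` B, continuous phi} /\ forall x, B x -> phi (f x) = x.
Proof.
move=> hF hG C0 rho0 fB.
pose phi (w : G) := xget (0 : F) [set x | B x /\ f x = w].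
have phiK x : B x -> phi (f x) = x.
  move=> Bx; apply: xget_unique => // y [By fyx].
  apply/(fdist_eq0 hF)/eqP; rewrite eq_le fdist_ge0// andbT.
  have ff0 : dG (f y) (f x) = 0 by apply/(fdist_eq0 hG).
  by have := fB y x By Bx; rewrite ff0 mulr0; apply.
exists phi; split => //.
apply/subspace_continuousP => _ [x Bx <-] V.
(* the identity from the subspace topology hides the value of phi *)
change (nbhs (phi (f x)) V ->
  within (f @` B) (nbhs (f x)) (phi @^-1` V)).
rewrite (phiK _ Bx) => /(fdist_topology hF) [e e0 eV].
have [s s0 srho] : exists2 s : R, 0 < s & (s%:E <= rho)%E.
  case: rho rho0 {fB} => [s||]//=; first by rewrite lte_fin => s0; exists s.
  by move=> _; exists 1 => //; exact: leey.
have C1 : 0 < C + 1 by lra.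
apply/(fdist_topology hG); exists (Num.min s (e / (C + 1))).
  by rewrite lt_min s0/= divr_gt0.
move=> _ /[swap] -[y By <-]; rewrite /dball/= lt_min => /andP[xys].
rewrite ltr_pdivlMr// => xye.
apply: eV; rewrite /dball /= (phiK _ By).
have xyrho : ((dG (f x) (f y))%:E < rho)%E by apply: lt_le_trans srho; rewrite lte_fin.
have := fB x y Bx By xyrho; have := fdist_ge0 (f x) (f y) hG.
by nra.
Qed.

(** * The local left inverse *)

Theorem theorem4p5 (R : realType) (F G : tvsType R)
    (dF : F -> F -> R) (dG : G -> G -> R)
    (hF : frechet_metric dF) (hG : frechet_metric dG)
    (supF : supremum_form dF) (supG : supremum_form dG)
    (U : set F) (hU : open U) (x0 : F) (hx0 : U x0)
    (rad : \bar R) (hrad : (0 < rad)%E)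
    (f : F -> G) (df : F -> {linear F -> G})
    (hf : b_differentiable dF dG rad U f df)
    (hinj : injective (df x0))
    (L0 : {linear G -> F}) (hL0 : rbounded dG dF rad L0)
    (hL0f : forall v : F, L0 (df x0 v) = v) :
  exists r0 : R,
    [/\ 0 < r0,
        dball dF x0 r0 `<=` U
      & exists phi : G -> F,
          {within f @` dball dF x0 r0, continuous phi} /\
          forall x : F, dball dF x0 r0 x -> phi (f x) = x].
Proof.
have [fdf _ dfcont] := hf.
have [C C0 hC] := rbounded_le hG hF hL0.
have [R1 R1_gt0 R1rad] : exists2 s : R, 0 < s & (s%:E <= rad)%E.
  case: rad hrad {hf dfcont hL0 hC} => [s||]//=.
    by rewrite lte_fin => s0; exists s.
  by move=> _; exists 1 => //; exact: leey.
(* C * eps <= 1/2 absorbs the error; eps <= 1 keeps the vector w below within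
   the radius where L0 is bounded *)
pose eps : R := (2 * (C + 1))^-1.
have eps0 : 0 < eps by rewrite invr_gt0; lra.
have epsE : eps * (2 * (C + 1)) = 1 by rewrite mulVf ?lt0r_neq0//; lra.
have [r1 r1_gt0 r1U] : exists2 e : R, 0 < e & dball dF x0 e `<=` U.
  by apply/(fdist_topology hF); exact: open_nbhs_nbhs.
have [r2 r2_gt0 r2eps] : exists2 e : R, 0 < e & dball dF x0 e `<=`
    [set q | U q -> (rsize dF dG rad (df q \- df x0)%R < eps%:E)%E].
  apply/(fdist_topology hF).
  have epsN : nbhs (0%E : \bar R) [set z | (z < eps%:E)%E].
    by apply: open_ereal_lt'; rewrite lte_fin.
  exact: dfcont x0 hx0 _ epsN.
(* two points of the ball are at distance less than R1 <= rad *)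
pose r0 := Num.min (Num.min r1 r2) (R1 / 2).
have r0_gt0 : 0 < r0 by rewrite !lt_min r1_gt0 r2_gt0/= divr_gt0.
have r0r1 : r0 <= r1 by rewrite !ge_min lexx.
have r0r2 : r0 <= r2 by rewrite !ge_min lexx orbT.
have r0R1 : r0 <= R1 / 2 by rewrite ge_min lexx orbT.
have BU : dball dF x0 r0 `<=` U.
  by move=> q qr; apply: r1U; exact: lt_le_trans qr r0r1.
have Beps q : dball dF x0 r0 q -> (rsize dF dG rad (df q \- df x0)%R <= eps%:E)%E.
  by move=> qr; apply/ltW/r2eps; [exact: lt_le_trans qr r0r2 | exact: BU].
exists r0; split => //.
have C2 : 0 <= 2 * C by lra.
apply: (lipschitz_left_inverse hF hG C2 hrad).
move=> x y xr yr fxy.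
have xyR1 : dF x y < R1.
  have := fdist_triangle hF x x0 y; rewrite (fdist_sym hF x x0).
  by move: xr yr; rewrite /dball/=; lra.
have xyrad : ((dF x y)%:E < rad)%E by apply: lt_le_trans R1rad; rewrite lte_fin.
have err := increment_error_le hF hG supF supG
  (fun q qr => fdf q (BU q qr)) Beps xr yr xyrad.
have dxy := fdist_ge0 x y hF.
pose u := f x - f y; pose w := df x0 (x - y) - u.
have wE : dG w 0 <= eps * dF x y.
  by rewrite /w -fdist_subr// (fdist_sym hG).
have wrad : ((dG w 0)%:E < rad)%E.
  apply: le_lt_trans xyrad; rewrite lee_fin; apply: le_trans wE _; nra.
have xyE : x - y = L0 u + L0 w by rewrite -linearD /w (addrC u) subrK hL0f.
have uE : dG u 0 = dG (f x) (f y) by rewrite -fdist_subr.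
have Lu : dF (L0 u) 0 <= C * dG (f x) (f y) by rewrite -uE; apply: hC; rewrite uE.
have Lw := hC w wrad.
have tri : dF x y <= dF (L0 u) 0 + dF (L0 w) 0.
  rewrite (fdist_subr x y hF) xyE.
  have := fdist_triangle hF (L0 u + L0 w) (L0 w) 0.
  by have := fdist_translation hF (L0 u) 0 (L0 w); rewrite add0r => ->.
have : C * dG w 0 <= C * (eps * dF x y) by rewrite ler_wpM2l.
have : C * (eps * dF x y) <= dF x y / 2 by nra.
by lra.
Qed.
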